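(* The family $(P_i)_{i\ge1}$ is a basis of the space of primitive elements of ${\cal H}_{ladder}$.
   Context: ${\cal H}_R$ is the commutative polynomial algebra over $\mathbb{Q}$ on isomorphism classes of rooted trees (finite connected simply connected graphs with a root, edges oriented away from the root), a Hopf algebra with coproduct the algebra morphism $\Delta(t)=1\otimes t+t\otimes1+\sum_CP^C(t)\otimes R^C(t)$, the sum over admissible cuts $C$ (nonempty edge sets meeting each root-to-vertex path at most once; $R^C(t)$ = component containing the root, $P^C(t)$ = product of the others). A ladder is a rooted tree in which every vertex has at most one outgoing edge; $l_i$ is the ladder with $i$ vertices, and $\Delta(l_n)=1\otimes l_n+l_n\otimes1+\sum_{j=1}^{n-1}l_j\otimes l_{n-j}$. ${\cal H}_{ladder}$ is the Hopf subalgebra of ${\cal H}_R$ generated by the ladders; its primitive elements are the $x$ with $\Delta(x)=x\otimes1+1\otimes x$. For $n\ge1$ let $\Psi_n(X_1,\dots,X_n)=\sum_{a_1+2a_2+\cdots+na_n=n}\frac{X_1^{a_1}\cdots X_n^{a_n}}{a_1!\cdots a_n!}$. Define $P_1=l_1$ and $P_n=l_n-\Psi_n(P_1,\dots,P_{n-1},0)$ for $n\ge2$. *)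

(* Defs.v *)
From HB Require Import structures.
From mathcomp Require Import all_boot all_order all_algebra.
From mathcomp Require Import finmap.
From mathcomp.multinomials Require Import monalg.

Set Implicit Arguments.
Unset Strict Implicit.
Unset Printing Implicit Defensive.

Import Order.TTheory GRing.Theory Num.Theory.
Local Open Scope ring_scope.

(* H_ladder = Q[l_1, l_2, ...] : polynomial algebra over Q in countably many
   variables; the variable with index i : nat stands for the ladder l_(i+1). *)
Definition Hlad := {malg rat[cmonom nat]}.

(* H_ladder (x) H_ladder = Q[l_i (x) 1, 1 (x) l_i] : variable (false, i) stands
   for l_(i+1) (x) 1 and variable (true, i) for 1 (x) l_(i+1). *)
Definition Hlad2 := {malg rat[cmonom (bool * nat)%type]}.

Definition ladder (n : nat) : Hlad := << ucm n.-1 >>.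

Definition ladL (n : nat) : Hlad2 := << ucm (false, n.-1) >>.
Definition ladR (n : nat) : Hlad2 := << ucm (true, n.-1) >>.

Definition monev (v : nat -> Hlad2) (m : cmonom nat) : Hlad2 :=
  \prod_(i <- finsupp m) v i ^+ m i.

Definition evH2 (v : nat -> Hlad2) (p : Hlad) : Hlad2 :=
  mmap (fun c : rat => c%:MP) (monev v) p.

Definition Delta_ladder (n : nat) : Hlad2 :=
  ladR n + ladL n + \sum_(1 <= j < n) ladL j * ladR (n - j).

Definition Delta (x : Hlad) : Hlad2 := evH2 (fun i => Delta_ladder i.+1) x.

Definition tensor1 (x : Hlad) : Hlad2 := evH2 (fun i => ladL i.+1) x.
Definition onetensor (x : Hlad) : Hlad2 := evH2 (fun i => ladR i.+1) x.

Definition primitive (x : Hlad) : Prop := Delta x = tensor1 x + onetensor x.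

(* Psi_n(X_1, ..., X_n) = sum_{a_1 + 2 a_2 + ... + n a_n = n}
      X_1^{a_1} ... X_n^{a_n} / (a_1! ... a_n!)
   with X k standing for X_k (k >= 1); a is indexed by 'I_n, a k = a_(k+1). *)
Definition Psi (n : nat) (X : nat -> Hlad) : Hlad :=
  \sum_(a : {ffun 'I_n -> 'I_n.+1} | (\sum_(k < n) k.+1 * a k)%N == n)
     ((\prod_(k < n) (a k)`!)%:R : rat)^-1 *: \prod_(k < n) X k.+1 ^+ a k.

(* Ps n = [:: P_1; ...; P_n] with P_n = l_n - Psi_n(P_1, ..., P_(n-1), 0) *)
Fixpoint Ps (n : nat) : seq Hlad :=
  if n is m.+1 then
    let s := Ps m in
    rcons s (ladder m.+1 - Psi m.+1 (fun k => if (k <= m)%N then nth 0 s k.-1 else 0))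
  else [::].

Definition P (n : nat) : Hlad := nth 0 (Ps n) n.-1.

(* Main.v *)
Require Import Defs.
From HB Require Import structures.
From mathcomp Require Import all_boot all_order all_algebra.
From mathcomp Require Import finmap.
From mathcomp.multinomials Require Import monalg.
Set Implicit Arguments.
Unset Strict Implicit.
Unset Printing Implicit Defensive.
Import GRing.Theory.
Local Open Scope ring_scope.

(* With L(t) = 1 + sum_n l_n t^n and P(t) = sum_n P_n t^n, the definition of the
   P_n says L = exp P, that is L' = P' L. Since Delta L = (L (x) 1)(1 (x) L), the
   logarithmic derivative gives Delta P = P (x) 1 + 1 (x) P.
   Freeness is triangularity: P_n - l_n only involves l_1, ..., l_(n-1).
   For spanning, let x be primitive in the variables l_1, ..., l_(N+1). Applying
   to Delta x the substitution l_j (x) 1 -> l_j (j <= N), 1 (x) l_(N+1) -> l_(N+1),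
   all other generators -> 0, gives x = x0 + p(l_(N+1)), where x0 is x at
   l_(N+1) = 0; sending both l_(N+1) (x) 1 and 1 (x) l_(N+1) to X, and the rest
   to 0, gives p(2X) = 2 p(X), so p = c X. Now x - c P_(N+1) is primitive in
   l_1, ..., l_N, and one concludes by induction on N. *)

(** * Substitution morphisms out of polynomial algebras *)

Section Evaluation.
Context (K : choiceType) (A : comAlgType rat).
Implicit Types (v : K -> A) (m : cmonom K) (x : {malg rat[cmonom K]}).

Definition mon_eval v m : A := \prod_(i <- finsupp m) v i ^+ m i.

Lemma mon_evalEw v m (d : {fset K}) : (finsupp m `<=` d)%fset ->
  mon_eval v m = \prod_(i <- d) v i ^+ m i.
Proof.
move=> le_md; apply: big_fset_incl => // i _.
by rewrite -cmE_eq0 => /eqP->; rewrite expr0.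
Qed.

Lemma mon_eval_mmorphism v : mmorphism (mon_eval v).
Proof.
split=> [m1 m2|]; last by rewrite /mon_eval mdom1 big_seq_fset0.
rewrite /mon_eval -/(mon_eval v m1) -/(mon_eval v m2) mdomD.
rewrite (@mon_evalEw v m1 _ (fsubsetUl _ (finsupp m2))).
rewrite (@mon_evalEw v m2 _ (fsubsetUr (finsupp m1) _)) -big_split /=.
by apply: eq_bigr => i _; rewrite cmM exprD.
Qed.

HB.instance Definition _ v :=
  isMultiplicative.Build (cmonom K) A (mon_eval v) (mon_eval_mmorphism v).

Definition eval v x : A := mmap (in_alg A) (mon_eval v) x.

HB.instance Definition _ v := GRing.RMorphism.copy (eval v) (mmap (in_alg A) (mon_eval v)).

Lemma eval_scalable v : scalable (eval v).
Proof. by move=> c x; rewrite /eval mmapZ /= mulr_algl. Qed.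

HB.instance Definition _ v :=
  GRing.isScalable.Build rat {malg rat[cmonom K]} A *:%R (eval v) (eval_scalable v).

Lemma evalU v i : eval v << ucm i >> = v i.
Proof.
rewrite /eval mmapU /= scale1r mul1r /mon_eval mdomU big_seq_fset1.
by rewrite cmUU expr1.
Qed.

Lemma eq_eval_in v w x :
    (forall m i, m \in msupp x -> i \in finsupp m -> v i = w i) ->
  eval v x = eval w x.
Proof.
move=> eq_vw; rewrite /eval /mmap; apply: eq_big_seq => m xm.
congr (_ * _); rewrite /mon_eval; apply: eq_big_seq => i im.
by rewrite (eq_vw m).
Qed.

End Evaluation.

Lemma malgUZ (K : choiceType) (c : rat) (k : K) :
  << c *g k >> = c *: << k >> :> {malg rat[K]}.
Proof.
by apply/malgP => k'; rewrite mcoeffZ !mcoeffU mulrnAr mulr1.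
Qed.

Lemma malgUM (K : monomType) (m1 m2 : K) :
  << mmul m1 m2 >> = << m1 >> * << m2 >> :> {malg rat[K]}.
Proof. by rewrite malgM_def fgmulUU mulr1. Qed.

Section Ext.
Context (K : choiceType) (A : lalgType rat).
Implicit Types f g : {lrmorphism {malg rat[cmonom K]} -> A}.

(** Induction on the degree: a monomial other than 1 is a variable times a monomial of smaller
    degree. Identities between substitutions can thus be checked on generators. *)
Lemma lrmorph_malg_ext f g : (forall i, f << ucm i >> = g << ucm i >>) -> f =1 g.
Proof.
move=> eqfg x; suff eqfgm (m : cmonom K) : f << m >> = g << m >>.
  rewrite (monalgE x) (linear_sum f) (linear_sum g); apply: eq_bigr => m _.
  by rewrite malgUZ (linearZ_LR f) (linearZ_LR g); congr (_ *: _); exact: eqfgm.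
have [d] := ubnP (mdeg m); elim: d m {x} => // d IHd m lt_md.
have [->|] := eqVneq m mone; first by rewrite !rmorph1.
move=> neq_m1; have [i mi_neq0] : exists i, m i != 0%N.
  case: (fset_0Vmem (finsupp m)) => [m0|[i im]]; last by exists i; rewrite cmE_neq0.
  by case/eqP: neq_m1; apply/eqP/cmP=> i; apply/eqP; rewrite cm1 cmE_eq0 m0.
have def_m : m = mmul (ucm i) (divcm m (ucm i)).
  apply/eqP/cmP => j; rewrite cmM divcmE cmU.
  by have [<-|_] := eqVneq i j; rewrite ?subn0 // subnKC // lt0n.
move: lt_md; rewrite {}def_m mdegM mdegU ltnS => lt_md.
rewrite malgUM (rmorphM f) (rmorphM g); congr (_ * _); first exact: eqfg.
exact: (IHd _ lt_md).
Qed.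

End Ext.

(** * Truncated power series and logarithmic derivatives *)

Section EqMod.
Context (A : comNzRingType).
Implicit Types p q r : {poly A}.

(** Congruence modulo X^n, so that truncated polynomials can stand for power series. *)
Definition eqmodX n p q := forall i, (i < n)%N -> p`_i = q`_i.

Lemma eqmodX_sym n p q : eqmodX n p q -> eqmodX n q p.
Proof. by move=> pq i /pq. Qed.

Lemma eqmodX_trans n p q r : eqmodX n p q -> eqmodX n q r -> eqmodX n p r.
Proof. by move=> pq qr i lt_in; rewrite pq ?qr. Qed.

Lemma eqmodXW m n p q : (m <= n)%N -> eqmodX n p q -> eqmodX m p q.
Proof. by move=> le_mn pq i lt_im; apply/pq/(leq_trans lt_im). Qed.

Lemma eqmodXD n p q p' q' :
  eqmodX n p q -> eqmodX n p' q' -> eqmodX n (p + p') (q + q').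
Proof. by move=> pq pq' i lt_in; rewrite !coefD pq ?pq'. Qed.

Lemma eqmodXM n p q p' q' :
  eqmodX n p q -> eqmodX n p' q' -> eqmodX n (p * p') (q * q').
Proof.
move=> pq pq' i lt_in; rewrite !coefM; apply: eq_bigr => j _.
have le_ji : (j <= i)%N by rewrite -ltnS.
by rewrite pq ?pq' ?(leq_ltn_trans _ lt_in) // leq_subr.
Qed.

Lemma eqmodX_prod n (I : finType) (f g : I -> {poly A}) :
  (forall i, eqmodX n (f i) (g i)) -> eqmodX n (\prod_i f i) (\prod_i g i).
Proof.
by move=> fg; elim/big_rec2: _ => [|i p q _ pq]; [|apply: eqmodXM].
Qed.

Lemma eqmodX_prod1 n (I : finType) (f : I -> {poly A}) :
  (forall i, eqmodX n (f i) 1) -> eqmodX n (\prod_i f i) 1.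
Proof.
move=> f1; elim/big_rec: _ => // i p _ p1.
by rewrite -[1]mulr1; apply: eqmodXM.
Qed.

(* In terms of generating series, a' = p a. *)
Definition newton (p a : nat -> A) :=
  forall n, a n.+1 *+ n.+1 = \sum_(j < n.+1) p j * a (n - j)%N.

Lemma newton_eqmodX (p a : nat -> A) n : newton p a ->
  eqmodX n (\poly_(i < n.+1) a i)^`() ((\poly_(i < n) p i) * \poly_(i < n.+1) a i).
Proof.
move=> pa i lt_in; rewrite coef_deriv coef_poly ltnS lt_in pa coefM.
apply: eq_bigr => j _; rewrite !coef_poly.
have le_ji : (j <= i)%N by rewrite -ltnS.
by rewrite (leq_ltn_trans le_ji) // ltnS (leq_trans (leq_subr _ _) (ltnW lt_in)).
Qed.

(** Leibniz rule: a' = p a and b' = q b give (ab)' = (p + q) ab. *)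
Lemma newtonM (p q a b : nat -> A) : newton p a -> newton q b ->
  newton (fun n => p n + q n) (fun n => \sum_(j < n.+1) a j * b (n - j)%N).
Proof.
move=> pa qb n.
(* Coefficient n of a derivative sees coefficient n+1 of the series, hence the cut at [n.+2] for [a]
   and [b] but [n.+1] for [p] and [q]. *)
pose pl c N : {poly A} := \poly_(i < N) c i.
have coef_ab i : (i <= n.+1)%N ->
  (pl a n.+2 * pl b n.+2)`_i = \sum_(j < i.+1) a j * b (i - j)%N.
  move=> le_in; rewrite coefM; apply: eq_bigr => j _; rewrite !coef_poly.
  have le_ji : (j <= i)%N by rewrite -ltnS.
  by rewrite ltnS (leq_trans le_ji) // ltnS (leq_trans (leq_subr _ _) le_in).
have /(_ n (ltnSn n)) : eqmodX n.+1 (pl a n.+2 * pl b n.+2)^`()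
   ((pl p n.+1 + pl q n.+1) * (pl a n.+2 * pl b n.+2)).
  rewrite derivM mulrDl; apply: eqmodXD; first rewrite mulrA.
    by apply: eqmodXM => //; apply: newton_eqmodX.
  by rewrite mulrCA; apply: eqmodXM => //; apply: newton_eqmodX.
rewrite coef_deriv coef_ab // => ->; rewrite coefM; apply: eq_bigr => j _.
by rewrite coef_ab ?(leq_trans (leq_subr _ _)) // coefD !coef_poly ltn_ord.
Qed.

Lemma eq_newton (p a b : nat -> A) : a =1 b -> newton p a -> newton p b.
Proof.
by move=> eq_ab pa n; rewrite -eq_ab pa; apply: eq_bigr => j _; rewrite eq_ab.
Qed.

(** The term j = n of the recurrence is p_n a_0 = p_n, so the series determines its logarithmic
    derivative recursively. *)
Lemma newton_inj (p q a : nat -> A) :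
  a 0 = 1 -> newton p a -> newton q a -> p =1 q.
Proof.
move=> a0 pa qa n; elim/ltn_ind: n => n IHn.
have := etrans (esym (pa n)) (qa n); rewrite !big_ord_recr /= subnn a0 !mulr1.
rewrite (eq_bigr (fun j : 'I_n => q j * a (n - j)%N)) => [/addrI //|j _].
by rewrite IHn.
Qed.

(** Splits off the end terms of a convolution to match the shape of [Delta_ladder]. Only positive
    indices are compared, because [ladL 0] and [ladR 0] are not 1. *)
Lemma conv_ends (a b l r : nat -> A) n :
    a 0 = 1 -> b 0 = 1 ->
    (forall j, a j.+1 = l j.+1) -> (forall j, b j.+1 = r j.+1) ->
  \sum_(j < n.+2) a j * b (n.+1 - j)%N =
    r n.+1 + l n.+1 + \sum_(1 <= j < n.+1) l j * r (n.+1 - j)%N.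
Proof.
move=> a0 b0 al br; rewrite -(big_mkord xpredT (fun j => a j * b (n.+1 - j)%N)).
rewrite big_nat_recl // big_nat_recr //= subnn a0 b0 mul1r mulr1 addrA addrAC.
rewrite subn0 al br big_add1; congr (_ + _ + _); apply: eq_big_nat => j /= lt_jn.
by rewrite al subSS -(subnSK lt_jn) br.
Qed.

End EqMod.

(** * The polynomials Psi_n as coefficients of an exponential *)

Section PsiNewton.
Context (A : comAlgType rat).
Implicit Types (X Y : nat -> A).

(* [Psi] in an arbitrary commutative Q-algebra. *)
Definition gpsi n X : A :=
  \sum_(a : {ffun 'I_n -> 'I_n.+1} | (\sum_(k < n) k.+1 * a k)%N == n)
     ((\prod_(k < n) (a k)`!)%:R : rat)^-1 *: \prod_(k < n) X k.+1 ^+ a k.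

Lemma eq_gpsi n X Y :
  (forall k, (k < n)%N -> X k.+1 = Y k.+1) -> gpsi n X = gpsi n Y.
Proof.
move=> eqXY; apply: eq_bigr => a _; congr (_ *: _).
by apply: eq_bigr => k _; rewrite eqXY.
Qed.

(* Truncation of exp(x t^k). *)
Definition texp N k (x : A) : {poly A} :=
  \sum_(a < N.+1) ((a`!%:R : rat)^-1 *: x ^+ a) *: 'X^(k * a).

(** Truncation of exp(X_1 t + ... + X_M t^M), each factor being cut after its N-th power. *)
Definition tprod M N X := \prod_(k < M) texp N k.+1 (X k.+1).

(** Expanding the product, a choice of exponents a contributes in degree a_1 + 2 a_2 + ... + n a_n;
    degree n selects the index set of Psi_n. *)
Lemma coef_tprod n X : (tprod n n X)`_n = gpsi n X.
Proof.
rewrite /tprod /texp bigA_distr_bigA /= coef_sum /gpsi [RHS]big_mkcond /=.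
apply: eq_bigr => a _.
have -> : \prod_(k < n) ((((a k)`!%:R^-1 : rat) *: X k.+1 ^+ a k) *: 'X^(k.+1 * a k))
  = (((\prod_(k < n) (a k)`!)%:R^-1 : rat) *: \prod_(k < n) X k.+1 ^+ a k) *:
     'X^(\sum_(k < n) k.+1 * a k) :> {poly A}.
  rewrite natr_prod -prodfV expr_sum -!scaler_prod /=.
  by rewrite scaler_prod.
rewrite coefZ coefXn eq_sym; case: eqP; by rewrite ?mulr1 ?mulr0.
Qed.

Lemma texp_recr N k x : texp N.+1 k x =
  texp N k x + ((N.+1`!%:R : rat)^-1 *: x ^+ N.+1) *: 'X^(k * N.+1).
Proof. by rewrite /texp big_ord_recr. Qed.

Lemma texp_eqmodX n N k x : (n <= N)%N ->
  eqmodX n.+1 (texp N k.+1 x) (texp n k.+1 x).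
Proof.
move/subnK <-; elim: (N - n)%N => // d IHd.
apply: eqmodX_trans IHd => i lt_in; rewrite addSn texp_recr coefD coefZ coefXn.
case: eqP => [def_i|]; last by rewrite mulr0 addr0.
have: (n < k.+1 * (d + n).+1)%N.
  by rewrite (leq_trans _ (leq_pmull _ _)) // ltnS leq_addl.
by rewrite -def_i ltnNge -ltnS lt_in.
Qed.

(** The rule for the derivative of exp(x t^(k+1)) holds exactly if the cut drops by one, since
    (a+1)/(a+1)! = 1/a!. *)
Lemma texp_deriv N k x :
  (texp N.+1 k.+1 x)^`() = ((x *+ k.+1) *: 'X^k) * texp N k.+1 x.
Proof.
rewrite /texp big_ord_recl muln0 derivD expr0 derivZ derivC scaler0 add0r.
rewrite linear_sum mulr_sumr /=; apply: eq_bigr => a _.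
rewrite derivZ derivXn -[bump 0 a]/(a.+1) -scalerMnr scalerMnl.
rewrite -scalerAl -scalerAr scalerA -exprD.
congr (_ *: 'X^_); last by rewrite mulnS.
rewrite mulnC mulrnA mulrnAl -scalerAr -exprS; congr (_ *+ _).
rewrite scalerMnl; congr (_ *: _).
rewrite factS natrM invfM -mulr_natl mulrA divff ?mul1r //.
by rewrite Num.Theory.pnatr_eq0.
Qed.

Lemma texp0 k x : texp 0 k x = 1.
Proof. by rewrite /texp big_ord1 muln0 invr1 scale1r scale1r. Qed.

Lemma texp_eq1 N k x : eqmodX k.+1 (texp N k.+1 x) 1.
Proof.
elim: N => [|N IHN]; first by rewrite texp0.
apply: eqmodX_trans IHN => i lt_ik; rewrite texp_recr coefD coefZ coefXn.
by rewrite ltn_eqF ?mulr0 ?addr0 // (leq_trans lt_ik) // leq_pmulr.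
Qed.

Lemma texp_linear N k x : eqmodX k.+2 (texp N.+1 k.+1 x) (1 + x *: 'X^(k.+1)).
Proof.
elim: N => [|N IHN].
  by rewrite texp_recr texp0 muln1 invr1 scale1r.
apply: eqmodX_trans IHN => i lt_ik; rewrite (texp_recr N.+1) coefD coefZ coefXn.
rewrite ltn_eqF ?mulr0 ?addr0 // (leq_trans lt_ik) // mulnS -[k.+2]addn1.
by rewrite leq_add2l muln_gt0.
Qed.

(** Leibniz rule over the factors; the term lost by differentiating a cut exponential has degree at
    least N. *)
Lemma tprod_deriv M N X : eqmodX N
  (tprod M N X)^`() ((\sum_(k < M) (X k.+1 *+ k.+1) *: 'X^k) * tprod M N X).
Proof.
elim: M => [|M IHM].
  by rewrite /tprod !big_ord0 derivC mul0r.
rewrite /tprod !big_ord_recr /= -/(tprod M N X) derivM mulrDl.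
apply: eqmodXD; first by rewrite mulrA; apply: eqmodXM.
rewrite mulrCA; apply: eqmodXM => //.
case: N {IHM} => [|N]; first by [].
rewrite texp_deriv; apply: eqmodXM => //.
by apply: eqmodX_sym; apply: texp_eqmodX.
Qed.

(** Factors of index above n are 1 modulo t^(n+1), and powers above n only add degrees above n. One
    truncation therefore yields all Psi_i with i <= N. *)
Lemma tprod_stable n N X : (n <= N)%N -> eqmodX n.+1 (tprod N N X) (tprod n n X).
Proof.
move/subnKC <-; move: (N - n)%N => d; rewrite /tprod big_split_ord /=.
rewrite -[\prod_(k < n) texp n _ _]mulr1; apply: eqmodXM.
  by apply: eqmodX_prod => k; apply: texp_eqmodX; rewrite leq_addr.
apply: eqmodX_prod1 => k.
by have := @texp_eq1 (n + d) (n + k) (X (n + k).+1); apply: eqmodXW; rewrite ltnS leq_addr.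
Qed.

Lemma newton_gpsi X : newton (fun j => X j.+1 *+ j.+1) (gpsi ^~ X).
Proof.
move=> n; have coef_t i : (i <= n.+1)%N -> (tprod n.+1 n.+1 X)`_i = gpsi i X.
  by move=> le_in; rewrite (tprod_stable X le_in) // coef_tprod.
have /(_ n (ltnSn n)) := @tprod_deriv n.+1 n.+1 X.
rewrite coef_deriv coef_t // => ->; rewrite coefM; apply: eq_bigr => j _.
rewrite coef_t ?(leq_trans (leq_subr _ _)) // coef_sum (bigD1 j) //= big1 ?addr0.
  by rewrite coefZ coefXn eqxx mulr1.
move=> i neq_ij; rewrite coefZ coefXn -[_ == _]/(j == i :> nat) eq_sym.
by rewrite (inj_eq val_inj) (negPf neq_ij) mulr0.
Qed.

Lemma gpsi0 X : gpsi 0 X = 1.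
Proof. by rewrite -coef_tprod /tprod big_ord0 coef1. Qed.

Lemma tprod_coef0 M N X : (tprod M N X)`_0 = 1.
Proof.
rewrite -[RHS](coef1 A 0); have: eqmodX 1 (tprod M N X) 1; last exact.
by apply: eqmodX_prod1 => k; have := @texp_eq1 N k (X k.+1); apply: eqmodXW.
Qed.

(** Modulo t^(n+2) the last factor is 1 + X_(n+1) t^(n+1), and the others have constant term 1. This
    is what makes the recursion for P_n solve l_n = Psi_n(P_1, ..., P_n). *)
Lemma gpsi_lead n X :
  gpsi n.+1 X = gpsi n.+1 (fun k => if (k <= n)%N then X k else 0) + X n.+1.
Proof.
pose Y k := if (k <= n)%N then X k else 0.
have tprodY : tprod n n.+1 Y = tprod n n.+1 X.
  by apply: eq_bigr => k _; rewrite /Y ltn_ord.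
have coef_lead Z : (tprod n.+1 n.+1 Z)`_n.+1 = (tprod n n.+1 Z)`_n.+1 + Z n.+1.
  rewrite /tprod big_ord_recr /= -/(tprod n n.+1 Z).
  have /(_ _ n.+1 (ltnSn _)) -> := eqmodXM (fun=> fun=> erefl) (@texp_linear n n (Z n.+1)).
  rewrite mulrDr mulr1 coefD -scalerAr coefZ coefMXn ltnn subnn; congr (_ + _).
  by rewrite tprod_coef0 mulr1.
by rewrite -!coef_tprod !coef_lead tprodY /Y ltnn addr0.
Qed.

End PsiNewton.

Lemma gpsi_morph (A B : comAlgType rat) (f : {lrmorphism A -> B}) n (X : nat -> A) :
  f (gpsi n X) = gpsi n (f \o X).
Proof.
rewrite /gpsi linear_sum; apply: eq_bigr => a _.
apply: (etrans (linearZ_LR f _ _)); congr (_ *: _).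
apply: (etrans (rmorph_prod f _ _ _)); apply: eq_bigr => k _.
exact: (rmorphXn f).
Qed.


(** * The relation L = exp P and primitivity of the P_n *)

(** Removes the factor n+1 that differentiation puts on P_(n+1). *)
Lemma additive_eq_mulrn (V : zmodType) (W : lmodType rat)
    (f f1 f2 : {additive V -> W}) x n :
  f (x *+ n.+1) = f1 (x *+ n.+1) + f2 (x *+ n.+1) -> f x = f1 x + f2 x.
Proof.
rewrite !raddfMn -mulrnDl -[f x *+ _]scaler_nat -[(_ + _) *+ _]scaler_nat.
by apply: scalerI; rewrite Num.Theory.pnatr_eq0.
Qed.

Lemma evH2E v : evH2 v =1 eval v.
Proof.
move=> x; rewrite /evH2 /eval /mmap; apply: eq_bigr => m _.
by rewrite mul_malgC mulr_algl.
Qed.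

Lemma size_Ps n : size (Ps n) = n.
Proof. by elim: n => //= n IHn; rewrite size_rcons IHn. Qed.

Lemma nth_Ps n k : (k < n)%N -> nth 0 (Ps n) k = P k.+1.
Proof.
elim: n => // n IHn; rewrite ltnS leq_eqVlt => /predU1P[->|lt_kn] //.
by rewrite /= nth_rcons size_Ps lt_kn IHn.
Qed.

Lemma PsiE n X : Psi n X = gpsi n X.
Proof. by []. Qed.

Lemma P_rec n : P n.+1 = ladder n.+1 - Psi n.+1 (fun k => if (k <= n)%N then P k else 0).
Proof.
rewrite {1}/P succnK -[Ps n.+1]/(rcons (Ps n) _) nth_rcons size_Ps ltnn eqxx !PsiE.
rewrite (@eq_gpsi _ n.+1 _ (fun k => if (k <= n)%N then P k else 0)) // => k _.
by case: ifP => // lt_kn; rewrite nth_Ps.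
Qed.

(** The series L needs constant term 1, whereas [ladder 0] equals [ladder 1]. *)
Definition ladder0 n : Hlad := if n is 0 then 1 else ladder n.

Lemma Psi_P n : Psi n P = ladder0 n.
Proof.
case: n => [|n]; first exact: gpsi0.
by rewrite PsiE gpsi_lead -PsiE P_rec addrC subrK.
Qed.

Lemma newton_ladder : newton (fun j => P j.+1 *+ j.+1) ladder0.
Proof.
move=> n; rewrite -Psi_P; rewrite (newton_gpsi P n).
by apply: eq_bigr => j _; rewrite -Psi_P.
Qed.

Lemma newton_morph (A B : comNzRingType) (f : {rmorphism A -> B}) (p a : nat -> A) :
  newton p a -> newton (f \o p) (f \o a).
Proof.
move=> pa n /=; rewrite -rmorphMn pa rmorph_sum.
by apply: eq_bigr => j _; rewrite rmorphM.
Qed.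

Lemma DeltaE x : Delta x = eval (fun i => Delta_ladder i.+1) x.
Proof. exact: evH2E. Qed.

Lemma tensor1E x : tensor1 x = eval (fun i => ladL i.+1) x.
Proof. exact: evH2E. Qed.

Lemma onetensorE x : onetensor x = eval (fun i => ladR i.+1) x.
Proof. exact: evH2E. Qed.

Lemma Delta_ladderS n : Delta (ladder n.+1) = Delta_ladder n.+1.
Proof. by rewrite DeltaE evalU. Qed.

Lemma tensor1_ladderS n : tensor1 (ladder n.+1) = ladL n.+1.
Proof. by rewrite tensor1E evalU. Qed.

Lemma onetensor_ladderS n : onetensor (ladder n.+1) = ladR n.+1.
Proof. by rewrite onetensorE evalU. Qed.

Lemma Delta1 : Delta 1 = 1.
Proof. by rewrite DeltaE; exact: (rmorph1 (eval _)). Qed.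

Lemma tensor1_1 : tensor1 1 = 1.
Proof. by rewrite tensor1E; exact: (rmorph1 (eval _)). Qed.

Lemma onetensor_1 : onetensor 1 = 1.
Proof. by rewrite onetensorE; exact: (rmorph1 (eval _)). Qed.

(** Coefficientwise form of Delta L = (L (x) 1)(1 (x) L). *)
Lemma Delta_ladder0 n : Delta (ladder0 n) =
  \sum_(j < n.+1) tensor1 (ladder0 j) * onetensor (ladder0 (n - j)%N).
Proof.
pose a j := tensor1 (ladder0 j); pose b j := onetensor (ladder0 j).
case: n => [|n].
  by rewrite big_ord1 tensor1_1 onetensor_1 mul1r; exact: Delta1.
apply: etrans (Delta_ladderS n) (esym _).
exact: (@conv_ends _ a b ladL ladR n tensor1_1 onetensor_1
         tensor1_ladderS onetensor_ladderS).
Qed.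

Lemma primitive_P n : primitive (P n.+1).
Proof.
pose f : {lrmorphism Hlad -> Hlad2} := eval (fun i => Delta_ladder i.+1).
pose f1 : {lrmorphism Hlad -> Hlad2} := eval (fun i => ladL i.+1).
pose f2 : {lrmorphism Hlad -> Hlad2} := eval (fun i => ladR i.+1).
rewrite /primitive DeltaE tensor1E onetensorE -/f -/f1 -/f2.
have nf := newton_morph f newton_ladder.
have nf12 := newtonM (newton_morph f1 newton_ladder) (newton_morph f2 newton_ladder).
have eqf k : (f \o ladder0) k = \sum_(j < k.+1) f1 (ladder0 j) * f2 (ladder0 (k - j)%N).
  apply: (etrans (esym (DeltaE _))); apply: (etrans (Delta_ladder0 k)).
  by apply: eq_bigr => j _; rewrite tensor1E onetensorE.
have f0 : (f \o ladder0) 0 = 1 := rmorph1 f.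
apply: (@additive_eq_mulrn _ _ f f1 f2 _ n).
(* Delta P' and P' (x) 1 + 1 (x) P' are both logarithmic derivatives of Delta L. *)
exact: (newton_inj f0 nf (eq_newton (fun k => esym (eqf k)) nf12) n).
Qed.

(** * Families triangular with respect to a sequence of linear maps *)

Section TriangularBasis.
Context (V : lmodType rat) (p l : nat -> V) (t : nat -> {linear V -> V}).
Hypothesis t_lt : forall n k, (k < n)%N -> t n (p k) = p k.
Hypothesis t_eq : forall n, t n (p n) = p n - l n.

(** [t n] fixes every term of the relation but the last, from which it removes c_n l_n; subtracting
    the relation leaves c_n l_n = 0. *)
Lemma triangular_free : (forall n, l n != 0) ->
  forall n (c : 'I_n -> rat), \sum_(i < n) c i *: p i = 0 -> forall i, c i = 0.
Proof.
move=> l_neq0; elim=> [|n IHn] c; first by move=> _ [].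
rewrite big_ord_recr /= => sum0.
have := congr1 (t n) sum0; rewrite linear0 linearD linearZ /= t_eq linear_sum /=.
under eq_bigr do rewrite linearZ /= t_lt //.
rewrite scalerBr addrA sum0 sub0r => /eqP; rewrite oppr_eq0 scaler_eq0.
rewrite (negPf (l_neq0 n)) orbF => /eqP cn0.
move: sum0; rewrite cn0 scale0r addr0 => /(IHn (fun i => c (widen_ord (leqnSn n) i))) c0 i.
have [lt_in|] := ltnP i n.
  by rewrite -(c0 (Ordinal lt_in)); congr c; apply: val_inj.
rewrite leq_eqVlt ltnNge -ltnS ltn_ord orbF => /eqP def_i.
by rewrite -cn0; congr c; apply: val_inj.
Qed.

Context (S : V -> Prop).
Hypothesis S_p : forall n, S (p n).
Hypothesis S_sub : forall c x y, S x -> S y -> S (x - c *: y).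
Hypothesis S0 : forall x, S x -> t 0 x = x -> x = 0.
Hypothesis S_step : forall n x, S x -> t n.+1 x = x ->
  exists c, x = t n x + c *: l n.

(** From x = t_n x + c l_n and t_n p_n = p_n - l_n, the vector x - c p_n is fixed by [t n], and
    induction applies to it. *)
Lemma triangular_span n x : S x -> t n x = x ->
  exists c : 'I_n -> rat, x = \sum_(i < n) c i *: p i.
Proof.
elim: n x => [|n IHn] x Sx tx.
  by exists (fun=> 0); rewrite big_ord0; apply: S0.
have [c def_x] := S_step Sx tx.
have [||d def_y] := IHn (x - c *: p n); first exact: S_sub.
  rewrite linearB linearZ /= t_eq scalerBr opprB addrCA addrA.
  by rewrite [X in X - _ = _]addrC -def_x.
(* [insub] fails only at the last index n, which receives c. *)
exists (fun i => if insub (val i) is Some j then d j else c).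
rewrite big_ord_recr /= insubF ?ltnn // -[LHS](subrK (c *: p n)) def_y.
by congr (_ + _); apply: eq_bigr => i _; rewrite valK.
Qed.

End TriangularBasis.

(** * Doubling the variable of a polynomial, and truncation to finitely many ladders *)

Lemma comp_polyZX (R : comNzRingType) (a : R) (p : {poly R}) k :
  (p \Po (a *: 'X))`_k = p`_k * a ^+ k.
Proof.
rewrite comp_polyE; under eq_bigr do rewrite exprZn scalerA.
rewrite -(poly_def _ (fun i => p`_i * a ^+ i)) coef_poly.
by case: ltnP => // le_pk; rewrite nth_default ?mul0r.
Qed.

(** Coefficientwise 2^k p_k = 2 p_k, which forces p_k = 0 unless k = 1. *)
Lemma comp_poly2X_additive (p : {poly rat}) :
  p \Po ('X *+ 2) = p *+ 2 -> p = p`_1 *: 'X.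
Proof.
rewrite -scaler_nat => p2; apply/polyP => k; rewrite coefZ coefX.
have := congr1 (fun q : {poly rat} => q`_k) p2.
rewrite comp_polyZX coefMn -[_`_k *+ 2]mulr_natr => /eqP.
have [->|neq_k1] := eqVneq k 1; first by rewrite mulr1.
rewrite -subr_eq0 -mulrBr mulf_eq0 mulr0 => /orP[/eqP //|].
rewrite subr_eq0 -natrX Num.Theory.eqr_nat -[X in _ == X]expn1 eqn_exp2l //.
by rewrite (negPf neq_k1).
Qed.

Definition trunc N : Hlad -> Hlad :=
  eval (fun i => if (i < N)%N then ladder i.+1 else 0).

HB.instance Definition _ N := GRing.LRMorphism.on (trunc N).

Lemma trunc_ladder N i :
  trunc N (ladder i.+1) = if (i < N)%N then ladder i.+1 else 0.
Proof. exact: evalU. Qed.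

(* [trunc N x = x] says that x is a polynomial in the first N ladders. *)
Lemma trunc_ext (A : lalgType rat) (f g : {lrmorphism Hlad -> A}) N :
    (forall i, (i < N)%N -> f (ladder i.+1) = g (ladder i.+1)) ->
  forall x, trunc N x = x -> f x = g x.
Proof.
move=> eq_fg x <-.
have := @lrmorph_malg_ext _ _ (f \o trunc N : {lrmorphism Hlad -> A})
  (g \o trunc N : {lrmorphism Hlad -> A}).
apply => i.
change (f (trunc N (ladder i.+1)) = g (trunc N (ladder i.+1))).
rewrite trunc_ladder; case: ifP => [/eq_fg //|_].
by rewrite (raddf0 f) (raddf0 g).
Qed.

Lemma eval_ladder x : eval (fun i => ladder i.+1) x = x.
Proof.
exact: (lrmorph_malg_ext (f := eval (fun i => ladder i.+1)) (g := idfun)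
          (fun i => evalU _ i) x).
Qed.

Lemma trunc_exists x : exists N, trunc N x = x.
Proof.
(* A strict bound on the variable indices occurring in x. *)
exists (\max_(m <- msupp x) \max_(i <- finsupp m) i.+1)%N.
rewrite -[RHS]eval_ladder; apply: eq_eval_in => m i xm im.
have lt_i : (i < \max_(m <- msupp x) \max_(i <- finsupp m) i.+1)%N.
  apply: (@leq_trans (\max_(j <- finsupp m) j.+1)).
    exact: (@leq_bigmax_seq _ _ xpredT S i im isT).
  exact: (@leq_bigmax_seq _ _ xpredT
            (fun m : cmonom nat => \max_(j <- finsupp m) j.+1)%N m xm isT).
by rewrite lt_i.
Qed.

Lemma trunc_Psi N n X :
  trunc N (Psi n X) = Psi n (fun k => trunc N (X k)).
Proof. exact: (gpsi_morph (trunc N)). Qed.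

Lemma truncB N x y : trunc N (x - y) = trunc N x - trunc N y.
Proof. exact: (raddfB (trunc N)). Qed.

Lemma trunc_Psi_P N n : (forall k, (k < n)%N -> trunc N (P k.+1) = P k.+1) ->
  trunc N (Psi n.+1 (fun k => if (k <= n)%N then P k else 0)) =
    Psi n.+1 (fun k => if (k <= n)%N then P k else 0).
Proof.
move=> tP; rewrite trunc_Psi; apply: eq_gpsi => k _.
by case: ifP => [/tP //|_]; apply: (raddf0 (trunc N)).
Qed.

Lemma trunc_P N n : (n < N)%N -> trunc N (P n.+1) = P n.+1.
Proof.
elim/ltn_ind: n => n IHn lt_nN.
rewrite P_rec truncB trunc_ladder lt_nN trunc_Psi_P // => k lt_kn.
exact/IHn/(ltn_trans lt_kn).
Qed.

(** P_(n+1) - l_(n+1) is a polynomial in P_1, ..., P_n, hence in l_1, ..., l_n: [trunc n] fixes it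
    and kills l_(n+1). *)
Lemma trunc_P_lead n : trunc n (P n.+1) = P n.+1 - ladder n.+1.
Proof.
rewrite P_rec truncB trunc_ladder ltnn.
rewrite trunc_Psi_P; last by move=> k; apply: trunc_P.
by rewrite sub0r addrAC subrr add0r.
Qed.

Lemma ladder_neq0 n : ladder n != 0.
Proof. by rewrite monalgU_eq0 oner_eq0. Qed.

Lemma linear_eqD_sub (V W : lmodType rat) (f f1 f2 : {linear V -> W}) c x y :
    f x = f1 x + f2 x -> f y = f1 y + f2 y ->
  f (x - c *: y) = f1 (x - c *: y) + f2 (x - c *: y).
Proof.
move=> fx fy; rewrite !linearB (linearZ_LR f) (linearZ_LR f1) (linearZ_LR f2) fx fy.
by rewrite scalerDr opprD addrACA.
Qed.

Lemma primitiveB c x y : primitive x -> primitive y -> primitive (x - c *: y).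
Proof.
rewrite /primitive !DeltaE !tensor1E !onetensorE.
exact: (@linear_eqD_sub _ _ (eval _) (eval _) (eval _)).
Qed.

(** * Primitive elements in the first N+1 ladders *)

Lemma self_double_eq0 (V : zmodType) (x : V) : x = x + x -> x = 0.
Proof. by rewrite -{1}[x]addr0 => /addrI <-. Qed.

(** Such an x is constant, so all three morphisms followed by [f] return x, and primitivity reads x
    = x + x. *)
Lemma primitive_trunc0 x : primitive x -> trunc 0 x = x -> x = 0.
Proof.
move=> px tx; pose f : {lrmorphism Hlad2 -> Hlad} := eval (fun=> 0).
have f_ev (v : nat -> Hlad2) : f (eval v x) = x.
  by apply: (@trunc_ext Hlad (f \o eval v : {lrmorphism Hlad -> Hlad}) idfun 0).
have fD : f (Delta x) = x by rewrite DeltaE; apply: f_ev.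
have fT : f (tensor1 x) = x by rewrite tensor1E; apply: f_ev.
have fO : f (onetensor x) = x by rewrite onetensorE; apply: f_ev.
apply: self_double_eq0; rewrite -{1}fD px.
exact: (etrans (raddfD f _ _) (congr2 +%R fT fO)).
Qed.

(* On the first N+1 ladders, the terms l_j (x) l_(n-j) die as soon as h kills
   1 (x) l_j for 1 <= j <= N. *)
Lemma lrmorph_Delta_ladder (A : lalgType rat) (h : {lrmorphism Hlad2 -> A}) N i :
    (i <= N)%N -> (forall j, (j < N)%N -> h (ladR j.+1) = 0) ->
  h (Delta_ladder i.+1) = h (ladR i.+1) + h (ladL i.+1).
Proof.
move=> le_iN h0.
have hD : h (Delta_ladder i.+1) = h (ladR i.+1) + h (ladL i.+1)
    + \sum_(1 <= j < i.+1) h (ladL j) * h (ladR (i.+1 - j)).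
  apply: etrans (raddfD h _ _) _; apply: etrans (congr1 (fun y => y + _) (raddfD h _ _)) _.
  apply: congr1; apply: etrans (raddf_sum h _ _ _) _.
  by apply: eq_bigr => j _; apply: (rmorphM h).
rewrite hD big_nat big1 ?addr0 // => j /andP[j_gt0 lt_ji].
have lt_N : (i.+1 - j.+1 < N)%N.
  by rewrite subSS (leq_trans _ le_iN) // ltn_subrL j_gt0 (leq_trans j_gt0).
by apply: etrans (congr1 _ _) (mulr0 _); rewrite -(subnSK lt_ji); apply: h0.
Qed.

Lemma lrmorph_eval_single (A B : comAlgType rat) (h : {lrmorphism A -> B}) N a x :
  h (eval (fun i => if i == N then a else 0) x) =
    eval (fun i => if i == N then h a else 0) (x : Hlad).
Proof.
apply: (lrmorph_malg_ext (f := h \o eval _) (g := eval _)) => i /=.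
by rewrite !evalU; case: ifP; rewrite ?raddf0.
Qed.

Section PolyAt.
Context (A : comAlgType rat) (a : A).

Definition poly_at (p : {poly rat}) : A := horner_alg a p.

Lemma poly_at_scalable : scalable poly_at.
Proof.
by move=> c p; rewrite /poly_at -mul_polyC rmorphM /= horner_algC mulr_algl.
Qed.

HB.instance Definition _ := GRing.RMorphism.copy poly_at (horner_alg a).
HB.instance Definition _ :=
  GRing.isScalable.Build rat {poly rat} A *:%R poly_at poly_at_scalable.

End PolyAt.

(** The one-variable polynomial is computed once at X, then specialised along X -> a. *)
Lemma eval_single_linear (A : comAlgType rat) N (a : A) c x :
    eval (fun i => if i == N then 'X else 0) (x : Hlad) = c *: 'X :> {poly rat} ->
  eval (fun i => if i == N then a else 0) x = c *: a.
Proof.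
move=> px; have := @lrmorph_eval_single {poly rat} A (poly_at a) N 'X x.
by rewrite px linearZ /= /poly_at horner_algX => <-.
Qed.

Lemma eval_single_double N x :
  eval (fun i => if i == N then 'X *+ 2 else 0) x =
    eval (fun i => if i == N then 'X else 0) (x : Hlad) \Po ('X *+ 2) :> {poly rat}.
Proof.
have := @lrmorph_eval_single {poly rat} {poly rat} (comp_poly ('X *+ 2 : {poly rat})) N 'X x.
by rewrite /= comp_polyX => ->.
Qed.

Lemma primitive_step N x : primitive x -> trunc N.+1 x = x ->
  exists c, x = trunc N x + c *: ladder N.+1.
Proof.
move=> px tx.
(* Chosen so that [f] after Delta is the identity on the first N+1 ladders, while x (x) 1 and 1 (x)
   x keep only the old ladders and the new one respectively. *)
pose f : {lrmorphism Hlad2 -> Hlad} := eval (fun bi : bool * nat =>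
  if bi.1 then (if bi.2 == N then ladder N.+1 else 0)
  else (if (bi.2 < N)%N then ladder bi.2.+1 else 0)).
(* Merging both copies of l_(N+1) into X makes Delta act as X -> 2X. *)
pose g : {lrmorphism Hlad2 -> {poly rat}} :=
  eval (fun bi : bool * nat => if bi.2 == N then 'X else 0).
pose p : {lrmorphism Hlad -> {poly rat}} :=
  eval (fun i => if i == N then 'X else 0).
have fR i : f (ladR i.+1) = if i == N then ladder N.+1 else 0 := evalU _ _.
have fL i : f (ladL i.+1) = if (i < N)%N then ladder i.+1 else 0 := evalU _ _.
have gR i : g (ladR i.+1) = if i == N then 'X else 0 := evalU _ _.
have gL i : g (ladL i.+1) = if i == N then 'X else 0 := evalU _ _.
have pE i : p (ladder i.+1) = if i == N then 'X else 0 := evalU _ _.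
pose D : {lrmorphism Hlad -> Hlad2} := eval (fun i => Delta_ladder i.+1).
pose T : {lrmorphism Hlad -> Hlad2} := eval (fun i => ladL i.+1).
pose O : {lrmorphism Hlad -> Hlad2} := eval (fun i => ladR i.+1).
have DE i : D (ladder i.+1) = Delta_ladder i.+1 := evalU _ _.
have TE i : T (ladder i.+1) = ladL i.+1 := evalU _ _.
have OE i : O (ladder i.+1) = ladR i.+1 := evalU _ _.
have DTO : D x = T x + O x.
  by rewrite -[LHS]DeltaE -[X in X + _]tensor1E -[X in _ + X]onetensorE.
have single_lt i : (i < N)%N -> (i == N) = false by move=> lt_iN; rewrite ltn_eqF.
have fT : f (T x) = trunc N x.
  apply: (@lrmorph_malg_ext _ _ (f \o T) (trunc N)) => i.
  by change (f (T (ladder i.+1)) = trunc N (ladder i.+1)); rewrite TE fL trunc_ladder.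
have fO : f (O x) = eval (fun i => if i == N then ladder N.+1 else 0) x.
  apply: (@lrmorph_malg_ext _ _ (f \o O) (eval _)) => i.
  change (f (O (ladder i.+1)) =
    eval (fun i => if i == N then ladder N.+1 else 0) << ucm i >>).
  by rewrite OE fR evalU.
have fD : f (D x) = x.
  apply: (@trunc_ext Hlad (f \o D) idfun N.+1) tx => i lt_iN.
  change (f (D (ladder i.+1)) = ladder i.+1); rewrite DE.
  rewrite (@lrmorph_Delta_ladder _ f N i lt_iN); last first.
    by move=> j lt_jN; rewrite fR single_lt.
  (* Exactly one summand survives: 1 (x) l_(N+1) when i = N, and l_(i+1) (x) 1 when i < N. *)
  apply: etrans (congr2 +%R (fR i) (fL i)) _; case: (ltngtP i N) lt_iN => [_ _|lt_Ni|-> _].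
  - exact: add0r.
  - by rewrite ltnS leqNgt lt_Ni.
  - exact: addr0.
have gT : g (T x) = p x.
  apply: (@lrmorph_malg_ext _ _ (g \o T) p) => i.
  by change (g (T (ladder i.+1)) = p (ladder i.+1)); rewrite TE gL pE.
have gO : g (O x) = p x.
  apply: (@lrmorph_malg_ext _ _ (g \o O) p) => i.
  by change (g (O (ladder i.+1)) = p (ladder i.+1)); rewrite OE gR pE.
have gD : g (D x) = p x \Po ('X *+ 2).
  apply: etrans (eval_single_double N x).
  apply: (@trunc_ext {poly rat} (g \o D) (eval _) N.+1) tx => i lt_iN.
  change (g (D (ladder i.+1)) =
    eval (fun i => if i == N then 'X *+ 2 else 0) << ucm i >>).
  rewrite DE evalU (@lrmorph_Delta_ladder _ g N i lt_iN); last first.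
    by move=> j lt_jN; rewrite gR single_lt.
  apply: etrans (congr2 +%R (gR i) (gL i)) _.
  by case: eqP => _; rewrite ?addr0 // mulr2n.
have pX : p x = (p x)`_1 *: 'X.
  apply: comp_poly2X_additive; rewrite -gD DTO mulr2n.
  exact: (etrans (raddfD g _ _) (congr2 +%R gT gO)).
(* Since p = cX, the image of 1 (x) x under [f] is c l_(N+1). *)
exists (p x)`_1; rewrite -(eval_single_linear (ladder N.+1 : Hlad) pX) -fO -fT.
by apply: etrans (esym fD) _; rewrite DTO; apply: (raddfD f).
Qed.

Theorem theorem9p5 :
  (forall i : nat, (0 < i)%N -> primitive (P i)) /\
  (forall (n : nat) (c : 'I_n -> rat),
      \sum_(i < n) c i *: P i.+1 = 0 -> forall i : 'I_n, c i = 0) /\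
  (forall x : Hlad, primitive x ->
      exists (n : nat) (c : 'I_n -> rat), x = \sum_(i < n) c i *: P i.+1).
Proof.
have tP n := @trunc_P n; have tP_lead := trunc_P_lead.
split=> [[|i] // _|]; first exact: primitive_P.
split=> [|x px].
  exact: (@triangular_free Hlad (fun i => P i.+1) (fun i => ladder i.+1)
            (fun n => trunc n) tP tP_lead (fun n => ladder_neq0 n.+1)).
have [n tx] := trunc_exists x; exists n.
exact: (@triangular_span Hlad (fun i => P i.+1) (fun i => ladder i.+1)
          (fun n => trunc n) tP_lead primitive primitive_P primitiveB
          primitive_trunc0 primitive_step n x px tx).
Qed.
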